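(* For every $G$-space $X$, $$\mathrm{cat}^{G,\infty}(X)\le\mathrm{TC}^{G,\infty}(X)\le\mathrm{cat}^{G\times G,\infty}(X\times X)\le 2\,\mathrm{cat}^{G,\infty}(X),$$ where $X\times X$ carries the product $G\times G$-action.
   Context: All spaces are well-pointed CW complexes, $G$ a topological group acting cellularly; $x_0\in X$ is the base point. $PX$ is the path space with compact-open topology. $\mathcal{P}_k(X)=\{(\gamma_1,\dots,\gamma_k)\in(PX)^k\mid G\gamma_i(1)=G\gamma_{i+1}(0),\ 1\le i\le k-1\}$, $\pi_k\colon\mathcal{P}_k(X)\to X\times X$, $\pi_k(\gamma_1,\dots,\gamma_k)=(\gamma_1(0),\gamma_k(1))$. The (reduced) sectional category $\mathrm{secat}(f)$ of $f\colon E\to B$ is the least $n\ge0$ such that $B$ has an open cover $U_0,\dots,U_n$ with maps $s_i\colon U_i\to E$, $f\circ s_i\simeq(U_i\hookrightarrow B)$. $\mathrm{TC}^{G,k}(X)=\mathrm{secat}(\pi_k)$ and $\mathrm{TC}^{G,\infty}(X)=\min_k\mathrm{TC}^{G,k}(X)$. $P^k_*(X)$ is the pullback of $\pi_k$ along $X\to X\times X$, $x\mapsto(x_0,x)$, i.e. $P^k_*(X)=\{(\gamma_1,\dots,\gamma_k)\in\mathcal{P}_k(X)\mid\gamma_1(0)=x_0\}$ with fibration $q_k(\gamma_1,\dots,\gamma_k)=\gamma_k(1)$. The $k$-effective LS category is $\mathrm{cat}^{G,k}(X)=\mathrm{secat}(q_k)$ and the effective LS category is $\mathrm{cat}^{G,\infty}(X)=\min_{k\ge1}\mathrm{cat}^{G,k}(X)$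 (note $\mathrm{cat}^{G,1}(X)=\mathrm{cat}(X)$, reduced). *)

(* Defs.v *)
From HB Require Import structures.
From mathcomp Require Import all_boot all_order all_algebra.
From mathcomp Require Import all_classical all_reals all_analysis.
From mathcomp Require Import Rstruct Rstruct_topology.

Import Order.TTheory GRing.Theory Num.Theory.
Local Open Scope classical_set_scope.
Local Open Scope ring_scope.

Notation RR := Rdefinitions.R.

Definition I01 : topologicalType := set_type (`[0, 1]%classic : set RR).
Lemma i0_mem : (0 : RR) \in (`[0, 1]%classic : set RR).
Proof. by rewrite inE /= in_itv /= lexx ler01. Qed.
Lemma i1_mem : (1 : RR) \in (`[0, 1]%classic : set RR).
Proof. by rewrite inE /= in_itv /= lexx ler01. Qed.
Definition i0 : I01 := exist _ 0 i0_mem.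
Definition i1 : I01 := exist _ 1 i1_mem.


Definition is_topological_group {G : topologicalType}
  (mul : G -> G -> G) (one : G) (inv : G -> G) : Prop :=
  [/\ associative mul, left_id one mul, left_inverse one inv mul,
      continuous (fun p : G * G => mul p.1 p.2) & continuous inv].

Definition is_continuous_action {G X : topologicalType}
  (mul : G -> G -> G) (one : G) (act : G -> X -> X) : Prop :=
  [/\ forall x, act one x = x,
      forall g h x, act (mul g h) x = act g (act h x) &
      continuous (fun p : G * X => act p.1 p.2)].

Definition prod_act {G X : Type} (act : G -> X -> X) (gh : G * G) (xy : X * X)
  : X * X := (act gh.1 xy.1, act gh.2 xy.2).

Definition sqnorm {n} (v : 'rV[RR]_n) : RR := \sum_(i < n) (v ord0 i) ^+ 2.
Definition disk n : set 'rV[RR]_n := [set v | sqnorm v <= 1].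
Definition odisk n : set 'rV[RR]_n := [set v | sqnorm v < 1].
Definition sphere n : set 'rV[RR]_n := [set v | sqnorm v = 1].

Record CWstructure (X : topologicalType) := {
  cw_cell : Type;
  cw_dim : cw_cell -> nat;
  cw_char : forall a, 'rV[RR]_(cw_dim a) -> X;
  cw_hausdorff : hausdorff_space X;
  cw_char_cont : forall a, {within disk (cw_dim a), continuous (cw_char a)};
  cw_char_homeo : forall a, exists psi : X -> 'rV[RR]_(cw_dim a),
      {within cw_char a @` odisk (cw_dim a), continuous psi} /\
      (forall v, odisk (cw_dim a) v -> psi (cw_char a v) = v);
  cw_partition : forall x : X, exists! a, (cw_char a @` odisk (cw_dim a)) x;
  cw_closure_finite : forall a, exists S : set cw_cell, finite_set S /\
      (forall b, S b -> (cw_dim b < cw_dim a)%N) /\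
      cw_char a @` sphere (cw_dim a) `<=`
        \bigcup_(b in S) (cw_char b @` odisk (cw_dim b));
  cw_weak : forall A : set X,
      closed A <-> forall a, closed (disk (cw_dim a) `&` cw_char a @^-1` A)
}.

Arguments cw_cell {X} c.
Arguments cw_dim {X c} a.
Arguments cw_char {X c} a _.

Definition skeleton {X : topologicalType} (C : CWstructure X) (n : nat) : set X :=
  \bigcup_(a in [set a : cw_cell C | (cw_dim a <= n)%N]) (cw_char a @` odisk (cw_dim a)).

Definition cellular_action {G X : topologicalType} (C : CWstructure X)
  (act : G -> X -> X) : Prop :=
  forall (g : G) (n : nat), act g @` skeleton C n `<=` skeleton C n.

Definition well_pointed {X : topologicalType} (x0 : X) : Prop :=
  forall (Y : topologicalType) (f : X -> Y) (h : I01 -> Y),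
    continuous f -> continuous h -> h i0 = f x0 ->
    exists H : X * I01 -> Y, [/\ continuous H,
      forall x, H (x, i0) = f x & forall t, H (x0, t) = h t].

(** [secat_le Etot p n]: the (reduced) sectional category of
    p : Etot -> B (Etot a subspace of E) is <= n. *)
Definition secat_le {E B : topologicalType} (Etot : set E) (p : E -> B)
  (n : nat) : Prop :=
  exists U : 'I_n.+1 -> set B,
    [/\ forall i, open (U i),
        \bigcup_i U i = setT &
        forall i, exists s : B -> E,
          [/\ {within U i, continuous s}, s @` U i `<=` Etot &
              exists H : B * I01 -> B,
                [/\ {within U i `*` setT, continuous H},
                    forall u, U i u -> H (u, i0) = p (s u) &
                    forall u, U i u -> H (u, i1) = u]]].

(** extended naturals: None = +oo *)
Definition enat := option nat.
Definition ele (a b : enat) : Prop :=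
  match a, b with
  | _, None => True
  | None, Some _ => False
  | Some m, Some n => (m <= n)%N
  end.
Definition edouble (a : enat) : enat := omap (muln 2) a.

Lemma ex_asbool (P : nat -> Prop) : (exists n, P n) -> exists n, `[< P n >].
Proof. by case=> n Pn; exists n; apply/asboolP. Qed.

Definition emin (P : nat -> Prop) : enat :=
  match pselect (exists n, P n) with
  | left h => Some (ex_minn (ex_asbool P h))
  | right _ => None
  end.

Definition secat {E B : topologicalType} (Etot : set E) (p : E -> B) : enat :=
  emin (secat_le Etot p).

Definition einf_pos (F : nat -> enat) : enat :=
  emin (fun n => exists k, (0 < k)%N /\ F k = Some n).

Definition PXamb (X : topologicalType) := {compact-open, I01 -> X}.
(** ambient space (PX)^k; for k >= 1 the index type 'I_(k.-1).+1 is 'I_k *)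
Definition PXk (X : topologicalType) (k : nat) :=
  {ptws 'I_(k.-1).+1 -> PXamb X}.

Definition Pk {G X : topologicalType} (act : G -> X -> X) (k : nat)
  : set (PXk X k) :=
  [set gam | (forall i, continuous (gam i : I01 -> X)) /\
     forall i j : 'I_(k.-1).+1, nat_of_ord j = i.+1 ->
       exists g : G, act g (gam i i1) = gam j i0].

Definition pik {X : topologicalType} (k : nat) (gam : PXk X k) : X * X :=
  (gam ord0 i0, gam ord_max i1).

Definition TCk {G X : topologicalType} (act : G -> X -> X) (k : nat) : enat :=
  secat (Pk act k) (@pik X k).

Definition TCinf {G X : topologicalType} (act : G -> X -> X) : enat :=
  einf_pos (TCk act).

Definition Pk_star {G X : topologicalType} (act : G -> X -> X) (x0 : X)
  (k : nat) : set (PXk X k) :=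
  [set gam | Pk act k gam /\ gam ord0 i0 = x0].

Definition qk {X : topologicalType} (k : nat) (gam : PXk X k) : X :=
  gam ord_max i1.

Definition catk {G X : topologicalType} (act : G -> X -> X) (x0 : X)
  (k : nat) : enat :=
  secat (Pk_star act x0 k) (@qk X k).

Definition catinf {G X : topologicalType} (act : G -> X -> X) (x0 : X) : enat :=
  einf_pos (catk act x0).

(* Main.v *)
Require Import Defs.
From HB Require Import structures.
From mathcomp Require Import all_boot all_order all_algebra.
From mathcomp Require Import all_classical all_reals all_analysis.
From mathcomp Require Import Rstruct Rstruct_topology.
From mathcomp Require Import zify lra.

Import Order.TTheory GRing.Theory Num.Theory numFieldNormedType.Exports.
Local Open Scope classical_set_scope.
Local Open Scope ring_scope.

(** The first two inequalities are obtained by moving sections around. From a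
    local section of [pik] over a homotopy [H], the path [H] run backwards in its
    first coordinate joins [x0] to the start of the first path, and prepending
    it as a new stage gives a section of [qk] with one more stage. Conversely,
    a pair of [k]-stage paths issued from [(x0, x0)] unfolds into one path with
    [2k] stages, by reversing the first one.

    For the product inequality, let [U_0, ..., U_n] be a categorical cover. As a
    CW complex is normal, there are continuous functions
    [psi_0, ..., psi_(n-1)] with [psi_j] positive only on [U_j] and, at each
    point outside [U_n], some [psi_j > 1/2]. For [0 < t <= 1/2] the open set
    [W_t] where no [psi_j] takes the value [t] splits into disjoint open pieces
    according to the first [j] with [psi_j > t], the piece of index [j] lying
    in [U_j]; hence [W_t] carries a section. A point lies outside at most [n] of
    the sets [W_t], so the [W_t * W_t], for [2n + 1] values of [t], cover the
    square. *)

(** * Path spaces and local sections *)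

Lemma cvg_initial_topology {S : choiceType} {T : topologicalType} (f : S -> T)
    (F : set_system S) (s : S) : Filter F ->
  F --> (s : initial_topology f) <-> f x @[x --> F] --> f s.
Proof.
move=> FF; split=> [Fs|Ffs]; first exact: (cvg_comp _ _ Fs (@initial_continuous _ _ f s)).
move=> A [_ [[B oB <-] Bs] BA]; apply: filterS BA _.
by apply: Ffs; exact: open_nbhs_nbhs.
Qed.

Lemma cvg_I01 {T : Type} (F : set_system T) (f : T -> I01) (t : I01) :
  Filter F -> (set_val (f x) : RR) @[x --> F] --> (set_val t : RR) ->
  f x @[x --> F] --> t.
Proof.
move=> FF cf A [_ [[B oB <-] Bt] BA].
have FB : F [set x | B (set_val (f x))] by apply: cf; exact: open_nbhs_nbhs.
by apply: (@filterS T F FF _ _ _ FB) => x; exact: BA.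
Qed.

Lemma compact_I01 : compact [set: I01].
Proof.
pose g (r : RR) : I01 := insubd i0 r.
have gK r : r \in (`[0, 1]%classic : set RR) -> set_val (g r) = r.
  by move=> r01; rewrite /g /insubd insubT.
have -> : [set: I01] = g @` `[0, 1]%classic.
  apply/seteqP; split => // -[r r01] _; exists r; first exact/set_mem.
  by apply: val_inj; rewrite /= -[RHS](gK _ r01).
apply: continuous_compact; last exact: segment_compact.
apply/subspace_continuousP => r r01.
apply: cvg_I01; rewrite gK ?inE//.
move=> D nD; rewrite /= !nbhs_simpl /within /=.
near=> x => x01; rewrite /= gK ?inE//.
by near: x; exact: nD.
Unshelve. all: by end_near. Qed.

(** One half of the exponential law at a single point, by the tube lemma for the compact set [K].
    Continuity of [f] is asked only on the slice over [x], as sections and homotopies below are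
    total functions controlled only on an open set. *)
Lemma curry_continuous_at {B Y : topologicalType} (f : B * I01 -> Y) (x : B) :
  (forall t, {for (x, t), continuous f}) ->
  {for x, continuous ((fun b t => f (b, t)) : B -> PXamb Y)}.
Proof.
move=> cf; apply/compact_open_cvgP => K O /= cK oO fKO.
near=> z => w /= [+ + <-]; near: z.
move/compact_near_coveringP/near_covering_withinP : cK; apply.
move=> v Kv; have [[P Q] [Px Qv] PQfO] : nbhs (x, v) (f @^-1` O).
  by apply: cf; move: oO; rewrite openE; apply; apply: fKO; exists v.
by exists (Q, P) => // -[b a] /= [Qb Pa] Kb; exact: PQfO.
Unshelve. all: by end_near. Qed.

(** Regularity of the interval gives a neighbourhood [R] of [t] whose closure [s x] still maps into
    [O]; this closure is compact, so mapping it into [O] is an open condition in the compact-open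
    topology. *)
Lemma eval_continuous_at {B Y : topologicalType} (s : B -> PXamb Y) (x : B) t :
  {for x, continuous s} -> continuous (s x : I01 -> Y) ->
  {for (x, t), continuous (fun p : B * I01 => (s p.1 : I01 -> Y) p.2)}.
Proof.
move=> cs csx D /=; rewrite /= nbhsE => -[ O [oO Ofuv]] /filterS; apply.
have [R Rt RO] : exists2 R, nbhs t R & forall z, closure R z -> O ((s x : I01 -> Y) z).
  have [] := @uniform_regular I01 t ((s x : I01 -> Y) @^-1` O).
    by apply: csx; exact: open_nbhs_nbhs.
  by move=> R ? ?; exists R.
exists (s @^-1` [set g | g @` (closure R) `<=` O], closure R).
  split; last by apply: filterS Rt; exact: subset_closure.
  apply: cs; apply: open_nbhs_nbhs; split; last by move=> ? [z /RO ? <-].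
  apply: compact_open_open => //.
  by rewrite -(setTI (closure R)); apply: compact_closedI; [exact: compact_I01|exact: closed_closure].
by case=> a r /= [sO cR]; apply: sO; exists r.
Qed.

Lemma ptws_continuous_at {I : Type} {B Y : topologicalType}
    (s : B -> {ptws I -> Y}) (x : B) :
  {for x, continuous s} <-> forall i, {for x, continuous (fun b => s b i)}.
Proof.
split=> [cs i|cs]; last first.
  by apply/cvg_sup => i; apply/cvg_initial_topology; exact: cs.
by move/cvg_sup: cs => /(_ i)/cvg_initial_topology.
Qed.

Lemma pair_continuous_at {B Y Z : topologicalType} (f : B -> Y) (g : B -> Z) x :
  {for x, continuous f} -> {for x, continuous g} ->
  {for x, continuous (fun b => (f b, g b))}.
Proof. by move=> cf cg; apply: cvg_pair. Qed.

Lemma pair_cst_continuous {Y Z : topologicalType} (y : Y) :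
  continuous (fun z : Z => (y, z)).
Proof. by move=> z; apply: pair_continuous_at; [exact: cvg_cst|exact: cvg_id]. Qed.

Lemma fst_continuous {Y Z : topologicalType} : continuous (@fst Y Z).
Proof. by case=> y z; exact: cvg_fst. Qed.

Lemma snd_continuous {Y Z : topologicalType} : continuous (@snd Y Z).
Proof. by case=> y z; exact: cvg_snd. Qed.

Lemma fst_continuous_at {B Y Z : topologicalType} (f : B -> Y * Z) x :
  {for x, continuous f} -> {for x, continuous (fun b => (f b).1)}.
Proof. by move=> cf; apply: continuous_comp cf _; exact: fst_continuous. Qed.

Lemma snd_continuous_at {B Y Z : topologicalType} (f : B -> Y * Z) x :
  {for x, continuous f} -> {for x, continuous (fun b => (f b).2)}.
Proof. by move=> cf; apply: continuous_comp cf _; exact: snd_continuous. Qed.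

Lemma open_setX {Y Z : topologicalType} (A : set Y) (A' : set Z) :
  open A -> open A' -> open (A `*` A').
Proof.
rewrite !openE => oA oA' [y z] [/= Ay Az]; exists (A, A') => //=.
by split; [exact: oA|exact: oA'].
Qed.

(** Continuity is asked at each point of [U] rather than within [U]. For open [U] the two agree, and
    the pointwise form passes easily to preimages and glued sections. *)
Definition local_section {E B : topologicalType} (Etot : set E) (p : E -> B)
    (U : set B) : Prop :=
  exists (s : B -> E) (H : B * I01 -> B), forall u, U u ->
    [/\ Etot (s u), {for u, continuous s},
        forall t, {for (u, t), continuous H},
        H (u, i0) = p (s u) & H (u, i1) = u].

Lemma secat_leP {E B : topologicalType} (Etot : set E) (p : E -> B) (n : nat) :
  secat_le Etot p n <->
  exists U : 'I_n.+1 -> set B,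
    [/\ forall i, open (U i), \bigcup_i U i = setT &
        forall i, local_section Etot p (U i)].
Proof.
split=> -[U [oU cU sU]]; exists U; split=> // i.
  have [s [cs sE [H [cH H0 H1]]]] := sU i; exists s, H => u Uu.
  split=> [||t||]; [by apply: sE; exists u| | |exact: H0|exact: H1].
    by move: cs; rewrite (continuous_open_subspace _ (oU i)); apply; rewrite inE.
  move: cH; rewrite continuous_open_subspace; last by apply: open_setX; [|exact: openT].
  by apply; rewrite inE.
have [s [H sH]] := sU i; exists s; split.
- rewrite (continuous_open_subspace _ (oU i)) => u /set_mem Uu.
  by have [] := sH u Uu.
- by move=> _ [u Uu <-]; have [] := sH u Uu.
- exists H; split; [|by move=> u /sH[]|by move=> u /sH[]].
  rewrite continuous_open_subspace; last by apply: open_setX; [|exact: openT].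
  by case=> u t /set_mem[/= Uu _]; have [_ _ cH _ _] := sH u Uu; exact: cH.
Qed.

Lemma eminP (P : nat -> Prop) n : emin P = Some n -> P n.
Proof. by rewrite /emin; case: pselect => // h [<-]; case: ex_minnP => m /asboolP. Qed.

Lemma emin_le (P : nat -> Prop) n : P n -> exists2 m, emin P = Some m & (m <= n)%N.
Proof.
move=> Pn; rewrite /emin; case: pselect => [h|[]]; last by exists n.
by case: ex_minnP => m _ mn; exists m => //; apply: mn; exact/asboolP.
Qed.

(** Reduces a comparison of minima over the number of stages to a transfer of sections from [k]
    stages to some number [l] of stages; [c] will be the identity or doubling. *)
Lemma ele_einf_pos_secat {E E' : nat -> topologicalType} {B B' : topologicalType}
    (Etot : forall k, set (E k)) (p : forall k, E k -> B)
    (Etot' : forall k, set (E' k)) (p' : forall k, E' k -> B') (c : nat -> nat) :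
  (forall k n, (0 < k)%N -> secat_le (Etot' k) (p' k) n ->
    exists2 l, (0 < l)%N & secat_le (Etot l) (p l) (c n)) ->
  ele (einf_pos (fun k => secat (Etot k) (p k)))
      (omap c (einf_pos (fun k => secat (Etot' k) (p' k)))).
Proof.
move=> h; case e': (einf_pos (fun k => secat (Etot' k) (p' k))) => [n|] /=; last by case: einf_pos.
have [k [k0 /eminP kn]] := eminP _ _ e'.
have [l l0 /emin_le[m em mn]] := h k n k0 kn.
rewrite /einf_pos; have [|m' -> m'm] := @emin_le (fun n => exists k, (0 < k)%N /\ secat (Etot k) (p k) = Some n) m.
  by exists l.
exact: leq_trans m'm mn.
Qed.

Definition rev01 (t : I01) : I01 := insubd i0 (1 - set_val t).

Lemma val_rev01 t : set_val (rev01 t) = 1 - set_val t :> RR.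
Proof.
have := set_mem (valP t); rewrite /= in_itv /= => /andP[t0 t1].
rewrite /rev01 /insubd insubT// inE /= in_itv /=.
by rewrite subr_ge0 t1 lerBlDr lerDl t0.
Qed.

Lemma rev01_0 : rev01 i0 = i1.
Proof. by apply: val_inj; apply: etrans (val_rev01 i0) _; exact: subr0. Qed.

Lemma rev01_1 : rev01 i1 = i0.
Proof. by apply: val_inj; apply: etrans (val_rev01 i1) _; exact: subrr. Qed.

Lemma rev01_continuous : continuous rev01.
Proof.
move=> t.
have cv : set_val x @[x --> t] --> (set_val t : RR).
  exact: (@initial_continuous _ _ (set_val : (`[0, 1]%classic : set RR) -> RR) t).
have h : (1 - (set_val x : RR)) @[x --> t] --> (1 - set_val t : RR).
  by apply: (@cvgB _ RR^o) cv; exact: cvg_cst.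
apply: (@cvg_I01 _ _ _ _ (nbhs_filter t)); rewrite (val_rev01 t).
suff -> : (fun x : I01 => set_val (rev01 x) : RR) = (fun x => 1 - set_val x) by [].
by apply/funext => x; exact: val_rev01.
Qed.

(** * Transfer of sections between [pik] and [qk] *)

Definition cons_path {X : topologicalType} {m : nat} (d : PXamb X)
    (gam : PXk X m.+1) : PXk X m.+2 :=
  fun i => if nat_of_ord i is j.+1 then gam (inord j) else d.

(** The new junction is an equality of points, so [one] witnesses its orbit condition. *)
Lemma cons_path_Pk {G X : topologicalType} (one : G) (act : G -> X -> X) m
    (d : PXamb X) (gam : PXk X m.+1) :
  (forall x, act one x = x) -> continuous (d : I01 -> X) ->
  (d : I01 -> X) i1 = (gam ord0 : I01 -> X) i0 ->
  Pk act m.+1 gam -> Pk act m.+2 (cons_path d gam).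
Proof.
move=> act1 cd dg [cgam jgam]; split.
  by move=> [[|i] ilt]; rewrite /cons_path /=; [exact: cd|exact: cgam].
move=> [i ilt] [j jlt]; rewrite /cons_path /= => ij; subst j.
case: i ilt jlt => [|i] ilt jlt.
  by exists one; rewrite act1 dg; congr (gam _ _); apply: val_inj; rewrite /= inordK.
by apply: jgam; rewrite !inordK // ltnW.
Qed.

Lemma local_section_TC_cat {G X : topologicalType} (one : G) (act : G -> X -> X)
    (x0 : X) m (U : set (X * X)) :
  (forall x, act one x = x) ->
  local_section (Pk act m.+1) (@pik X m.+1) U ->
  local_section (Pk_star act x0 m.+2) (@qk X m.+2) ((fun x => (x0, x)) @^-1` U).
Proof.
move=> act1 [s [H sH]].
(* The first coordinate of [H] supplies the new stage; the second is the homotopy from the unchanged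
   endpoint to [x]. *)
pose d x : PXamb X := fun t => (H ((x0, x), rev01 t)).1.
exists (fun x => cons_path (d x) (s (x0, x))), (fun q => (H ((x0, q.1), q.2)).2).
move=> x /sH[Ps cs cH H0 H1].
have cx0 := @pair_cst_continuous X X x0.
have cd t : {for (x, t), continuous (fun q : X * I01 => (H ((x0, q.1), rev01 q.2)).1)}.
  apply: fst_continuous_at.
  apply: (@continuous_comp _ _ _ (fun q : X * I01 => ((x0, q.1), rev01 q.2)) H); last exact: cH.
  apply: pair_continuous_at.
    by apply: continuous_comp (cx0 _); exact: fst_continuous.
  by apply: continuous_comp; [exact: snd_continuous|exact: rev01_continuous].
split.
- split; last by rewrite /cons_path /d /= rev01_0 H1.
  apply: (@cons_path_Pk _ _ one) => //.
    move=> t; apply: (@continuous_comp _ _ _ (fun t => (x, t)) (fun q : X * I01 => (H ((x0, q.1), rev01 q.2)).1)).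
      exact: pair_cst_continuous.
    exact: cd.
  by rewrite /d rev01_1 H0.
- apply/ptws_continuous_at => -[[|i] ilt]; rewrite /cons_path /=.
    exact: (@curry_continuous_at _ _ (fun q => (H (x0, q.1, rev01 q.2)).1)).
  move/ptws_continuous_at: cs => /(_ (inord i)) csi.
  exact: (continuous_comp (cx0 x) csi).
- move=> t; apply: snd_continuous_at.
  apply: (@continuous_comp _ _ _ (fun q : X * I01 => ((x0, q.1), q.2)) H); last exact: cH.
  apply: pair_continuous_at; last exact: snd_continuous.
  by apply: continuous_comp (cx0 _); exact: fst_continuous.
- by rewrite H0 /qk /cons_path /=; congr (s _ _ _); apply: val_inj; rewrite /= inordK.
- by rewrite H1.
Qed.

(** With the reversed first coordinates placed before the second ones, the two halves meet at the
    base point, and the endpoint of [gam] becomes the pair of endpoints of the new path. *)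
Definition unfold_path {X : topologicalType} {m : nat} (gam : PXk (X * X)%type m.+1) :
    PXk X (m.+1 + m.+1) :=
  fun i => if (i <= m)%N
           then fun t => ((gam (inord (m - i)) : I01 -> X * X) (rev01 t)).1
           else fun t => ((gam (inord (i - m.+1)) : I01 -> X * X) t).2.

Lemma unfold_path_Pk {G X : topologicalType}
    (mul : G -> G -> G) (one : G) (inv : G -> G) (act : G -> X -> X) x0 m
    (gam : PXk (X * X)%type m.+1) :
  is_topological_group mul one inv -> is_continuous_action mul one act ->
  Pk_star (prod_act act) (x0, x0) m.+1 gam ->
  Pk act (m.+1 + m.+1) (unfold_path gam).
Proof.
move=> [_ _ mulV _ _] [act1 actM _] [[cgam jgam] gam0]; split.
  move=> i; rewrite /unfold_path; case: ifP => _ t.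
    apply: fst_continuous_at; apply: continuous_comp; first exact: rev01_continuous.
    exact: cgam.
  by apply: snd_continuous_at; exact: cgam.
move=> [i ilt] [j jlt] /= ij; subst j; rewrite /unfold_path /=.
have [im|mi] := ltnP i m.
  rewrite (ltnW im) rev01_0 rev01_1.
  have [|g gE] := jgam (inord (m - i.+1)) (inord (m - i)).
    by rewrite !inordK ?ltnS ?leq_subr// subnSK.
  (* Reversal exchanges the two sides of a junction, so the group element is inverted. *)
  exists (inv g.1); rewrite -gE /prod_act /= -actM mulV act1 //.
case: (ltngtP i m) mi => // [mi _|im _].
  have [|g gE] := jgam (inord (i - m.+1)) (inord (i.+1 - m.+1)).
    rewrite !inordK; first by rewrite subSn.
    - by rewrite /= in jlt; lia.
    - by rewrite /= in jlt; lia.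
  by exists g.2; rewrite -gE.
(* The middle junction: stage [m] ends and stage [m.+1] begins at [x0]. *)
subst i; exists one; rewrite act1 rev01_1 !subnn.
have -> : inord 0 = ord0 :> 'I_m.+1 by apply: val_inj; rewrite /= inordK.
by rewrite gam0.
Qed.

(** The homotopy [H] is kept, since [pik] of the unfolded path is the endpoint of the original one.
    Continuity is checked after uncurrying, where reversal is a change of the time variable. *)
Lemma local_section_cat_TC {G X : topologicalType}
    (mul : G -> G -> G) (one : G) (inv : G -> G) (act : G -> X -> X) x0 m
    (U : set (X * X)) :
  is_topological_group mul one inv -> is_continuous_action mul one act ->
  local_section (Pk_star (prod_act act) (x0, x0) m.+1) (@qk (X * X)%type m.+1) U ->
  local_section (Pk act (m.+1 + m.+1)) (@pik X (m.+1 + m.+1)) U.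
Proof.
move=> grp actC [s [H sH]].
exists (fun u => unfold_path (s u)), H => u /sH[Ps cs cH H0 H1]; split => //.
- exact: unfold_path_Pk grp actC Ps.
- have cst j t := eval_continuous_at _ _ t ((ptws_continuous_at _ _).1 cs j) (Ps.1.1 j).
  apply: (ptws_continuous_at (fun u => unfold_path (s u)) u).2 => i; rewrite /unfold_path.
  case: (boolP (i <= m)%N) => _.
    apply: (@curry_continuous_at _ _ (fun q : (X * X) * I01 =>
      ((s q.1 (inord (m - i)) : I01 -> X * X) (rev01 q.2)).1)) => t.
    apply: fst_continuous_at.
    apply: (@continuous_comp _ _ _ (fun q : (X * X) * I01 => (q.1, rev01 q.2))
      (fun q => (s q.1 (inord (m - i)) : I01 -> X * X) q.2)); last exact: cst.
    apply: pair_continuous_at; first exact: fst_continuous.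
    by apply: continuous_comp; [exact: snd_continuous|exact: rev01_continuous].
  apply: (@curry_continuous_at _ _ (fun q : (X * X) * I01 =>
      ((s q.1 (inord (i - m.+1)) : I01 -> X * X) q.2).2)) => t.
  by apply: snd_continuous_at; exact: cst.
- rewrite H0 /qk /pik /unfold_path /= rev01_0 subn0.
  have -> : (m + m.+1 <= m)%N = false by apply/negbTE; rewrite -ltnNge ltn_addl.
  have -> : inord m = ord_max :> 'I_m.+1 by apply: val_inj; rewrite /= inordK.
  have -> : inord (m + m.+1 - m.+1) = ord_max :> 'I_m.+1.
    by apply: val_inj; rewrite /= inordK addnK.
  by case: (s u ord_max i1).
Qed.

(** * Gluing and products of sections *)

Lemma local_section_glue {E B : topologicalType} {I : Type} (Etot : set E)
    (p : E -> B) (U : I -> set B) (W : set B) (idx : B -> I) :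
  (forall i, local_section Etot p (U i)) ->
  (forall x, W x -> U (idx x) x /\ \forall y \near x, idx y = idx x) ->
  local_section Etot p W.
Proof.
move=> /choice[s /choice[H sH]] Widx.
exists (fun x => s (idx x) x), (fun q => H (idx q.1) q) => x Wx.
have [Ux idxE] := Widx x Wx; have [Ps cs cH H0 H1] := sH _ _ Ux; split => //.
  move: cs; apply: cvg_trans; apply: near_eq_cvg.
  by apply: filterS idxE => y ->.
move=> t; move: (cH t); apply: cvg_trans; apply: near_eq_cvg.
exact: filterS (fun q => fun e => congr1 (H^~ q) (esym e)) (@fst_continuous _ _ (x, t) _ idxE).
Qed.

Definition pair_path {X : topologicalType} {k : nat} (gam gam' : PXk X k) :
    PXk (X * X)%type k :=
  fun i t => ((gam i : I01 -> X) t, (gam' i : I01 -> X) t).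

(** Both sections have [k] stages, so they pair stage by stage; the product action allows
    independent group elements in the two factors at each junction. *)
Lemma local_section_cat_prod {G X : topologicalType} (act : G -> X -> X) x0 k
    (U V : set X) :
  local_section (Pk_star act x0 k) (@qk X k) U ->
  local_section (Pk_star act x0 k) (@qk X k) V ->
  local_section (Pk_star (prod_act act) (x0, x0) k) (@qk (X * X)%type k) (U `*` V).
Proof.
move=> [s [H sH]] [s' [H' sH']].
exists (fun u => pair_path (s u.1) (s' u.2)),
  (fun q => (H (q.1.1, q.2), H' (q.1.2, q.2))).
move=> [x y] [/= /sH[Ps cs cH H0 H1] /sH'[Ps' cs' cH' H'0 H'1]]; split.
- have [[cg jg] g0] := Ps; have [[cg' jg'] g0'] := Ps'.
  split; last by rewrite /pair_path g0 g0'.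
  split=> [i t|i j ij]; first by apply: pair_continuous_at; [exact: cg|exact: cg'].
  have [g gE] := jg i j ij; have [g' gE'] := jg' i j ij.
  by exists (g, g'); rewrite /prod_act /pair_path /= gE gE'.
- apply/ptws_continuous_at => i.
  apply: (@curry_continuous_at _ _ (fun q : (X * X) * I01 =>
    ((s q.1.1 i : I01 -> X) q.2, (s' q.1.2 i : I01 -> X) q.2))) => t.
  have cst := eval_continuous_at _ _ t ((ptws_continuous_at _ _).1 cs i) (Ps.1.1 i).
  have cst' := eval_continuous_at _ _ t ((ptws_continuous_at _ _).1 cs' i) (Ps'.1.1 i).
  apply: pair_continuous_at.
    apply: (@continuous_comp _ _ _ (fun q : (X * X) * I01 => (q.1.1, q.2))
      (fun q => (s q.1 i : I01 -> X) q.2)); last exact: cst.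
    apply: pair_continuous_at; last exact: snd_continuous.
    by apply: fst_continuous_at; exact: fst_continuous.
  apply: (@continuous_comp _ _ _ (fun q : (X * X) * I01 => (q.1.2, q.2))
    (fun q => (s' q.1 i : I01 -> X) q.2)); last exact: cst'.
  apply: pair_continuous_at; last exact: snd_continuous.
  by apply: snd_continuous_at; exact: fst_continuous.
- move=> t; apply: pair_continuous_at.
    apply: (@continuous_comp _ _ _ (fun q : (X * X) * I01 => (q.1.1, q.2)) H);
      last exact: cH.
    apply: pair_continuous_at; last exact: snd_continuous.
    by apply: fst_continuous_at; exact: fst_continuous.
  apply: (@continuous_comp _ _ _ (fun q : (X * X) * I01 => (q.1.2, q.2)) H');
    last exact: cH'.
  apply: pair_continuous_at; last exact: snd_continuous.
  by apply: snd_continuous_at; exact: fst_continuous.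
- by rewrite H0 H'0.
- by rewrite H1 H'1.
Qed.

(** * Urysohn functions on CW complexes *)

Lemma within_closedP {T U : topologicalType} (K : set T) (f : T -> U) :
  closed K ->
  {within K, continuous f} <-> forall D, closed D -> closed (K `&` f @^-1` D).
Proof.
move=> cK; split=> [/continuous_closedP h D /h|h]; first by rewrite closed_setSI.
by apply/continuous_closedP => D /h; rewrite closed_setSI.
Qed.

Lemma eq_continuous_within {T U : topologicalType} (K : set T) (f g : T -> U) :
  (forall x, K x -> f x = g x) ->
  {within K, continuous f} -> {within K, continuous g}.
Proof.
by move=> fg; apply: subspace_eq_continuous => x /set_mem; exact: fg.
Qed.

Lemma sqnorm_continuous n : continuous (@sqnorm n).
Proof.
rewrite /sqnorm; elim: (index_enum _) => [|i r IH] v.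
  rewrite (_ : (fun _ => _) = cst 0); first exact: (@cst_continuous 'rV[RR]_n RR 0 v).
  by apply/funext => w; rewrite big_nil.
rewrite (_ : (fun _ => _) =
    (fun w : 'rV[RR]_n => w ord0 i ^+ 2 + \sum_(j <- r) w ord0 j ^+ 2)); last first.
  by apply/funext => w; rewrite big_cons.
have cx : continuous (fun w : 'rV[RR]_n => w ord0 i) by exact: coord_continuous.
exact: (cvgD (cvgM (cx v) (cx v)) (IH v)).
Qed.

Lemma closed_disk n : closed (disk n).
Proof.
have -> : disk n = @sqnorm n @^-1` [set x | x <= 1] by [].
apply: preimage_closed; [by move=> v _; exact: sqnorm_continuous|exact: closed_le].
Qed.

Lemma closed_sphere n : closed (sphere n).
Proof.
have -> : sphere n = @sqnorm n @^-1` [set 1] by [].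
apply: preimage_closed; [by move=> v _; exact: sqnorm_continuous|exact: closed_eq].
Qed.

Lemma compact_disk n : compact (disk n).
Proof.
have cN : compact [set v : 'rV[RR]_n | forall i, (`[-1, 1]%classic : set RR) (v ord0 i)].
  by apply: (@rV_compact RR n (fun=> `[-1, 1]%classic)) => _; exact: segment_compact.
apply: subclosed_compact (closed_disk n) cN _ => v vd i /=.
have vi1 : (v ord0 i) ^+ 2 <= 1.
  apply: le_trans vd; rewrite /sqnorm (bigD1 i)//= lerDl.
  by apply: sumr_ge0 => j _; exact: sqr_ge0.
by rewrite in_itv /=; apply/andP; split; nra.
Qed.

Lemma closed_cell_image {X : topologicalType} (C : CWstructure X) (a : cw_cell C)
    (D : set 'rV[RR]_(cw_dim a)) :
  closed (disk (cw_dim a) `&` D) -> closed (cw_char a @` (disk (cw_dim a) `&` D)).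
Proof.
move=> cD; apply: compact_closed; first exact: cw_hausdorff C.
apply: continuous_compact.
  by apply: continuous_subspaceW (cw_char_cont _ C a); exact: subIsetl.
by apply: subclosed_compact cD (compact_disk _) _; exact: subIsetl.
Qed.

(* The attaching map of [a] meets finitely many open cells, each contained in a
   compact closed cell on which [f] is already known to be continuous. *)
Lemma closed_sphere_preimage {X : topologicalType} (C : CWstructure X)
    (a : cw_cell C) (f : X -> RR) (D : set RR) :
  (forall b : cw_cell C, (cw_dim b < cw_dim a)%N ->
    {within disk (cw_dim b), continuous (f \o cw_char b)}) ->
  closed D -> closed (sphere (cw_dim a) `&` (f \o cw_char a) @^-1` D).
Proof.
move=> cf cD; have [S [finS [ltS subS]]] := cw_closure_finite _ C a.
pose F := \bigcup_(b in S) cw_char b @` (disk (cw_dim b) `&` (f \o cw_char b) @^-1` D).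
have cF : closed F.
  apply: (@closed_bigcup X {classic cw_cell C}) => // b Sb.
  apply: closed_cell_image; by apply: (within_closedP _ _ (@closed_disk _)).1 cD; exact/cf/ltS.
have -> : sphere (cw_dim a) `&` (f \o cw_char a) @^-1` D =
    sphere (cw_dim a) `&` (disk (cw_dim a) `&` cw_char a @^-1` F).
  apply/seteqP; split=> v /= [sv].
    move=> Dv; split=> //; split; first by rewrite /disk/= sv.
    have [b Sb [w ow wv]] := subS _ (imageP _ sv).
    exists b => //; exists w => //; split; first exact: ltW.
    by rewrite /= wv.
  by case=> _ [b Sb [w [_ /= Dw] <-]].
by apply: closedI; [exact: closed_sphere|exact: (cw_weak _ C F).1].
Qed.

(** The open cells partition the space, and [cw_char_homeo] makes each characteristic map injective
    on the open disk, so a point has a unique cell and unique coordinates in it. *)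
Lemma cw_coordinates {X : topologicalType} (C : CWstructure X) :
  exists e : X -> {a : cw_cell C & 'rV[RR]_(cw_dim a)},
    [/\ forall x, odisk (cw_dim (tag (e x))) (tagged (e x)),
        forall x, cw_char (tag (e x)) (tagged (e x)) = x &
        forall (a : cw_cell C) w, odisk (cw_dim a) w ->
          e (cw_char a w) = Tagged (fun a : cw_cell C => 'rV[RR]_(cw_dim a)) w].
Proof.
have /choice[e eP] : forall x, exists t : {a : cw_cell C & 'rV[RR]_(cw_dim a)},
    odisk (cw_dim (tag t)) (tagged t) /\ cw_char (tag t) (tagged t) = x.
  move=> x; have [a [[w ow wx] _]] := cw_partition _ C x.
  by exists (Tagged (fun a : cw_cell C => 'rV[RR]_(cw_dim a)) w).
exists e; split=> [x|x|a w ow]; [by have [] := eP x|by have [] := eP x|].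
have [] := eP (cw_char a w); case: (e _) => b v /= ov vw.
have [c [_ cU]] := cw_partition _ C (cw_char a w).
have ca : c = a by apply: cU; exists w.
have cb : c = b by apply: cU; exists v.
move: ov vw; rewrite -cb ca in v * => ov vw.
have [psi [_ psiK]] := cw_char_homeo _ C a.
by rewrite -(psiK _ ow) -vw psiK.
Qed.

(** By closure finiteness a boundary point lands in an open cell of smaller dimension; this drives
    the induction on skeleta. *)
Lemma tag_disk_le {X : topologicalType} (C : CWstructure X)
    (e : X -> {a : cw_cell C & 'rV[RR]_(cw_dim a)}) (a : cw_cell C) v :
  (forall (a : cw_cell C) w, odisk (cw_dim a) w ->
     e (cw_char a w) = Tagged (fun a : cw_cell C => 'rV[RR]_(cw_dim a)) w) ->
  disk (cw_dim a) v ->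
  e (cw_char a v) = Tagged (fun a : cw_cell C => 'rV[RR]_(cw_dim a)) v \/
  sphere (cw_dim a) v /\ (cw_dim (tag (e (cw_char a v))) < cw_dim a)%N.
Proof.
move=> eP; rewrite /disk /= le_eqVlt => /orP[/eqP sv|ov]; last by left; exact: eP.
right; split=> //; have [S [_ [ltS subS]]] := cw_closure_finite _ C a.
have [b Sb [w ow <-]] := subS _ (imageP _ sv).
by rewrite eP //=; exact: ltS.
Qed.

(** The strict bound makes the case [n = 0] vacuous, so that the induction can start from a
    discontinuous function. *)
Definition cell_continuous {X : topologicalType} (C : CWstructure X) (n : nat)
    (f : X -> RR) : Prop :=
  forall a : cw_cell C, (cw_dim a < n)%N ->
    {within disk (cw_dim a), continuous (f \o cw_char a)}.

(** Tietze extension on each [n]-cell separately, from its boundary together with the preimage of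
    [A]; off the open [n]-cells [f] is kept. *)
Lemma cell_continuous_extend {X : topologicalType} (C : CWstructure X)
    (e : X -> {a : cw_cell C & 'rV[RR]_(cw_dim a)}) (A : set X) (n : nat) (f : X -> RR) :
  (forall (a : cw_cell C) w, odisk (cw_dim a) w ->
     e (cw_char a w) = Tagged (fun a : cw_cell C => 'rV[RR]_(cw_dim a)) w) ->
  (forall x, odisk (cw_dim (tag (e x))) (tagged (e x))) ->
  (forall x, cw_char (tag (e x)) (tagged (e x)) = x) ->
  closed A ->
  (forall D, closed D -> closed (A `&` f @^-1` D)) ->
  (forall x, `|f x| <= 1) -> cell_continuous C n f ->
  exists f' : X -> RR,
    [/\ forall x, A x -> f' x = f x, forall x, `|f' x| <= 1,
        cell_continuous C n.+1 f' &
        forall x, (cw_dim (tag (e x)) < n)%N -> f' x = f x].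
Proof.
move=> eP eo ex cA cfA f1 cf.
have ext : forall a : cw_cell C, exists g : 'rV[RR]_(cw_dim a) -> RR,
    cw_dim a = n -> [/\ continuous g, forall v, `|g v| <= 1 &
     forall v, disk (cw_dim a) v -> sphere (cw_dim a) v \/ A (cw_char a v) ->
       g v = f (cw_char a v)].
  move=> a; have [an|/negP na] := eqVneq (cw_dim a) n; last by exists (fun=> 0) => /eqP.
  pose K := sphere (cw_dim a) `|` (disk (cw_dim a) `&` cw_char a @^-1` A).
  have cK : closed K.
    by apply: closedU; [exact: closed_sphere|exact: (cw_weak _ C A).1].
  have cKf : {within K, continuous (f \o cw_char a)}.
    apply: (within_closedP _ _ cK).2 => D cD; rewrite setIUl; apply: closedU.
      by apply: closed_sphere_preimage cD => b; rewrite an; exact: cf.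
    by rewrite -setIA; apply: (cw_weak _ C (A `&` f @^-1` D)).1; exact: cfA.
  have [|g [gf cg g1]] := @continuous_bounded_extension 'rV[RR]_(cw_dim a) RR
    pseudometric_normal K cK (f \o cw_char a) 1 ltr01 cKf.
    by move=> v _; exact: f1.
  exists g => _; split=> // v dv Kv; rewrite -gf//.
  by rewrite inE; case: Kv => ?; [left|right].
have [g gP] : exists g : forall a : cw_cell C, 'rV[RR]_(cw_dim a) -> RR,
    forall a : cw_cell C, cw_dim a = n ->
    [/\ continuous (g a), forall v, `|g a v| <= 1 &
     forall v, disk (cw_dim a) v -> sphere (cw_dim a) v \/ A (cw_char a v) ->
       g a v = f (cw_char a v)].
  by exists (fun a => sval (cid (ext a))) => a; exact: svalP (cid (ext a)).
exists (fun x => if cw_dim (tag (e x)) == n then g (tag (e x)) (tagged (e x)) else f x).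
split.
- move=> x Ax; case: eqP => // dn; have [_ _ ->] := gP _ dn; first by rewrite ex.
    by apply: ltW; exact: eo.
  by right; rewrite ex.
- by move=> x; case: eqP => // /gP[_ + _]; apply.
- move=> a; rewrite ltnS leq_eqVlt => /orP[/eqP an|an].
    have [cg _ gf] := gP a an.
    apply: (eq_continuous_within _ _ _ _ (continuous_subspaceT cg)) => v dv /=.
    (* Boundary points of an [n]-cell lie in lower cells, where the new function is still [f], and
       [g a] agrees with [f] there. *)
    have [->|[sv ltv]] := tag_disk_le C e a v eP dv; first by rewrite /= an eqxx.
    rewrite -an ltn_eqF// gf //; by left.
  apply: (eq_continuous_within _ _ _ _ (cf a an)) => v dv /=.
  have [->|[sv ltv]] := tag_disk_le C e a v eP dv; first by rewrite /= ltn_eqF.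
  by rewrite ltn_eqF// (ltn_trans ltv).
- by move=> x xn; rewrite ltn_eqF.
Qed.

(** The indicator of [B], continuous on the union of [A] and [B], is extended one dimension at a
    time. The value at a point is fixed once its cell has been treated, and the weak topology makes
    the limit continuous. *)
Lemma cw_urysohn {X : topologicalType} (C : CWstructure X) (A B : set X) :
  closed A -> closed B -> A `&` B = set0 ->
  exists f : X -> RR, [/\ continuous f, forall x, A x -> f x = 0 &
    forall x, B x -> f x = 1].
Proof.
move=> cA cB AB0; have [e [eo ex eP]] := cw_coordinates C.
pose chi : X -> RR := \1_B.
have chiA x : A x -> chi x = 0.
  move=> Ax; rewrite /chi indicE memNset// => Bx.
  by have : set0 x by rewrite -AB0.
have chiB x : B x -> chi x = 1 by move=> Bx; rewrite /chi indicE mem_set.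
pose good n (f : X -> RR) := [/\ forall x, (A `|` B) x -> f x = chi x,
  forall x, `|f x| <= 1 & cell_continuous C n f].
(* Stated for every pair, vacuously when the function is not good, so that choice yields an operator
   to iterate. *)
have /choice[F FP] : forall p : nat * (X -> RR), exists f' : X -> RR,
    good p.1 p.2 -> good p.1.+1 f' /\
      forall x, (cw_dim (tag (e x)) < p.1)%N -> f' x = p.2 x.
  case=> n f /=; have [[fchi f1 cf]|ng] := pselect (good n f); last by exists f.
  have cAB : closed (A `|` B) by exact: closedU.
  have [|f' [f'f f'1 cf' f'e]] := @cell_continuous_extend _ C e _ n f eP eo ex cAB _ f1 cf.
    have f0 x : A x -> f x = 0 by move=> Ax; rewrite fchi; [exact: chiA|left].
    have f1' x : B x -> f x = 1 by move=> Bx; rewrite fchi; [exact: chiB|right].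
    move=> D cD; have -> : (A `|` B) `&` f @^-1` D =
        (A `&` [set _ | D 0]) `|` (B `&` [set _ | D 1]).
      apply/seteqP; split=> x /=.
        by move=> [[Px|Px]]; [rewrite f0//; left|rewrite f1'//; right].
      by move=> [] [Px Dx]; split; [left|rewrite f0|right|rewrite f1'].
    have cst (P : Prop) : closed [set _ : X | P].
      have [p|np] := pselect P.
        by rewrite (_ : [set _ | P] = setT); [exact: closedT|apply/seteqP; split].
      by rewrite (_ : [set _ | P] = set0); [exact: closed0|apply/seteqP; split].
    by apply: closedU; apply: closedI.
  by exists f' => _; split=> //; split=> // x ABx; rewrite f'f// fchi.
pose f_ := fix rec n := if n is m.+1 then F (m, rec m) else chi.
have f_good n : good n (f_ n).
  elim: n => [|n /(FP (n, f_ n))[]//].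
  split=> [//|x|//]; rewrite /= /chi indicE.
  by case: (x \in B); rewrite ?normr1 ?normr0 ?ler01.
have f_stable n x : (cw_dim (tag (e x)) < n)%N -> f_ n x = f_ (cw_dim (tag (e x))).+1 x.
  elim: n => // n IH; rewrite ltnS leq_eqVlt => /orP[/eqP ->//|xn].
  by have [_ /(_ x xn) /= ->] := FP (n, f_ n) (f_good n); exact: IH.
pose f x := f_ (cw_dim (tag (e x))).+1 x.
exists f; split.
(* On the closed cell [a] the limit agrees with stage [(cw_dim a).+1], which is continuous there. *)
- apply/continuous_closedP => D cD; apply: (cw_weak _ C _).2 => a.
  apply: (within_closedP _ _ (@closed_disk _)).1 cD.
  have [_ _ /(_ a (ltnSn _)) cfa] := f_good (cw_dim a).+1.
  apply: (eq_continuous_within _ _ _ _ cfa) => v dv; apply: (f_stable (cw_dim a).+1 (cw_char a v)).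
  have [->|[_ ltv]] := tag_disk_le C e a v eP dv; first exact: ltnSn.
  exact: ltnW.
- by move=> x Ax; have [/(_ x) fx _ _] := f_good (cw_dim (tag (e x))).+1; rewrite /f fx; [exact: chiA|left].
- by move=> x Bx; have [/(_ x) fx _ _] := f_good (cw_dim (tag (e x))).+1; rewrite /f fx; [exact: chiB|right].
Qed.

(** * Covers of the square of a CW complex *)

(** Induction on [m]: sets are traded one by one for functions positive only on them, while the sets
    [psi j > 1/2] and the untreated [V j] still cover. At [m = n] the set [V n] alone is left
    untreated. *)
Lemma cw_shrinking {X : topologicalType} (C : CWstructure X) (n : nat)
    (V : nat -> set X) (m : nat) :
  (forall j, open (V j)) -> (forall x, exists2 j, (j <= n)%N & V j x) ->
  (m <= n)%N ->
  exists psi : nat -> X -> RR,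
    [/\ forall j, continuous (psi j),
        forall j x, (j < m)%N -> 0 < psi j x -> V j x &
        forall x, (exists2 j, (j < m)%N & 2^-1 < psi j x) \/
                  (exists2 j, (m <= j <= n)%N & V j x)].
Proof.
move=> oV cV; elim: m => [_|m IH mn].
  exists (fun _ _ => 0); split=> // [j|x]; first exact: cst_continuous.
  by right; have [j] := cV x; exists j.
have [psi [cpsi psiV psiU]] := IH (ltnW mn).
(* [O] is what is covered without [V m]. Its complement lies in [V m], so a Urysohn function can be
   [1] off [O] and [0] off [V m]. *)
pose O := \bigcup_(j in [set j | (j < m)%N]) (psi j @^-1` [set r | 2^-1 < r]) `|`
  \bigcup_(j in [set j | (m < j <= n)%N]) V j.
have oO : open O.
  apply: openU; apply: bigcup_open => // j _.
  by apply: open_comp; [move=> x _; exact: cpsi|exact: open_gt].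
have VO x : O x \/ V m x.
  have [[j jm jx]|[j /andP[]]] := psiU x; first by left; left; exists j.
  rewrite leq_eqVlt => /orP[/eqP<-|mj jn Vj]; first by right.
  by left; right; exists j => //=; rewrite mj.
have [||| f [cf f0 f1]] := cw_urysohn C (~` V m) (~` O).
- exact: open_closedC.
- exact: open_closedC.
- by apply/seteqP; split=> x // -[nV nO]; have [] := VO x.
exists (fun j => if j == m then f else psi j); split.
- by move=> j; case: eqP.
- move=> j x; rewrite ltnS leq_eqVlt; case: eqP => [-> _|_ /=]; last exact: psiV.
  by move=> fx; apply: contrapT => /f0 fx0; rewrite fx0 ltxx in fx.
- move=> x; have [[[j /= jm jx]|[j /= jmn jx]]|nO] := pselect (O x).
  + by left; exists j; [exact: ltnW|rewrite ltn_eqF].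
  + by right; exists j.
  + by left; exists m; rewrite ?eqxx// f1//; lra.
Qed.

(** As no [psi j x] equals [t], each of the finitely many comparisons with [t] is stable near [x],
    and the search depends only on them. *)
Lemma first_index_locally_constant {X : topologicalType} (n : nat)
    (psi : nat -> X -> RR) (t : RR) (x : X) :
  (forall j, continuous (psi j)) -> (forall j, (j < n)%N -> psi j x != t) ->
  \forall y \near x, (forall j, (j < n)%N -> psi j y != t) /\
    find (fun j => t < psi j y) (iota 0 n) = find (fun j => t < psi j x) (iota 0 n).
Proof.
move=> cpsi xt.
have h : forall j : 'I_n, \forall y \near x,
    psi j y != t /\ (t < psi j y) = (t < psi j x).
  move=> j; have [tx|xt'|/eqP e] := ltgtP t (psi j x).
  - have : nbhs x (psi j @^-1` [set r | t < r]).
      by apply: (cpsi j x); apply: open_nbhs_nbhs; split=> //; exact: open_gt.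
    by apply: filterS => y /= ty; rewrite ty gt_eqF.
  - have : nbhs x (psi j @^-1` [set r | r < t]).
      by apply: (cpsi j x); apply: open_nbhs_nbhs; split=> //; exact: open_lt.
    by apply: filterS => y /= yt; rewrite lt_eqF//; split=> //; apply/negbTE; rewrite -leNgt ltW.
  - by have := xt j (ltn_ord j); rewrite eq_sym e.
apply: (filterS _ (filter_forall _ h)) => y hy; split=> [j jn|].
  by have [] := hy (Ordinal jn).
apply: eq_in_find => j; rewrite mem_iota /= add0n => jn.
by have [_] := hy (Ordinal jn).
Qed.

Lemma cw_refined_cover {X : topologicalType} (C : CWstructure X) (n : nat)
    (U : 'I_n.+1 -> set X) :
  (forall i, open (U i)) -> \bigcup_i U i = setT ->
  exists (W : nat -> set X) (idx : nat -> X -> 'I_n.+1),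
    [/\ forall k, open (W k),
        forall k x, W k x ->
          U (idx k x) x /\ \forall y \near x, idx k y = idx k x &
        forall x y, exists2 k, (k <= 2 * n)%N & W k x /\ W k y].
Proof.
move=> oU cU.
have [||//|psi [cpsi psiU psiV]] :=
    @cw_shrinking X C n (fun j => U (inord j)) n.
- by move=> j; exact: oU.
- move=> x; have [i _ Ux] : (\bigcup_i U i) x by rewrite cU.
  by exists i; [exact: leq_ord|rewrite inord_val].
(* Distinct levels in []0, 1/2]]; the shift by [2] puts the largest one, at [k = 0], at [1/2]. *)
pose t k : RR := (k%:R + 2)^-1.
have t_gt0 k : 0 < t k by rewrite invr_gt0 ltr_wpDl.
have t_le k : t k <= 2^-1 by rewrite lef_pV2 ?posrE ?ltr_wpDl// lerDr.
have t_inj : injective t.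
  by move=> k l /invr_inj/addIr/eqP; rewrite eqr_nat => /eqP.
(* [find] returns [n] when no function exceeds the level, and [n] is the index of the last set. *)
pose fst_idx k x := find (fun j => t k < psi j x) (iota 0 n).
have fst_le k x : (fst_idx k x <= n)%N.
  by rewrite -[X in (_ <= X)%N](size_iota 0); exact: find_size.
pose W k := [set x | forall j, (j < n)%N -> psi j x != t k].
exists W, (fun k x => inord (fst_idx k x)); split.
- move=> k; rewrite openE => x Wx.
  by have := first_index_locally_constant _ _ _ _ cpsi Wx; apply: filterS => y [].
- move=> k x Wx; split; last first.
    have := first_index_locally_constant _ _ _ _ cpsi Wx.
    by apply: filterS => y [_ e]; rewrite /fst_idx e.
  have [lt_n|] := ltnP (fst_idx k x) n.
    apply: psiU => //; apply: lt_trans (t_gt0 k) _.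
    have : has (fun j => t k < psi j x) (iota 0 n) by rewrite has_find size_iota.
    by move=> /(nth_find 0%N); rewrite nth_iota.
  (* No function exceeds the level, hence none exceeds [1/2], and the point must lie in the last
     set. *)
  move=> ge_n; have idxE : fst_idx k x = n by apply/eqP; rewrite eqn_leq fst_le.
  have [[j jn jx]|[j]] := psiV x; last by rewrite -eqn_leq idxE => /eqP <-.
  have : has (fun j => t k < psi j x) (iota 0 n).
    by apply/hasP; exists j; rewrite ?mem_iota//; exact: le_lt_trans jx.
  by rewrite has_find size_iota -/(fst_idx k x) idxE ltnn.
- move=> x y; apply: contrapT => nk.
  (* Otherwise each of the [2 * n + 1] levels is the value of some function at [x] or at [y].
     Function and point determine the level, but there are only [2 * n] such choices. *)
  have /choice[c cP] : forall k : 'I_(2 * n).+1, exists c : 'I_n + 'I_n,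
      match c with inl j => psi j x = t k | inr j => psi j y = t k end.
    move=> k; apply: contrapT => nc; apply: nk; exists k; first exact: leq_ord.
    split=> j jn; apply/eqP => e; apply: nc.
      by exists (inl (Ordinal jn)).
    by exists (inr (Ordinal jn)).
  have c_inj : injective c.
    move=> k l kl; apply: ord_inj; apply: t_inj.
    by have := cP k; have := cP l; rewrite kl; case: (c l) => j -> ->.
  by have := leq_card c c_inj; rewrite card_sum !card_ord mul2n addnn ltnn.
Qed.

Lemma secat_le_cat_prod {G X : topologicalType} (C : CWstructure X)
    (act : G -> X -> X) x0 k n :
  secat_le (Pk_star act x0 k) (@qk X k) n ->
  secat_le (Pk_star (prod_act act) (x0, x0) k) (@qk (X * X)%type k) (2 * n).
Proof.
move=> /secat_leP[U [oU cU sU]].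
have [W [idx [oW WU Wxy]]] := cw_refined_cover C n U oU cU.
apply/secat_leP; exists (fun k => W k `*` W k); split=> [i||i].
- exact: open_setX.
- apply/seteqP; split=> // -[x y] _; have [l ln [Wx Wy]] := Wxy x y.
  by exists (Ordinal (ln : (l < (2 * n).+1)%N)).
- by apply: local_section_cat_prod; apply: (local_section_glue _ _ U _ (idx i) sU (WU i)).
Qed.

(** * The chain of inequalities *)

Theorem mainTheorem4 (G X : topologicalType)
  (mul : G -> G -> G) (one : G) (inv : G -> G) (act : G -> X -> X)
  (C : CWstructure X) (x0 : X) :
  is_topological_group mul one inv ->
  is_continuous_action mul one act ->
  cellular_action C act ->
  well_pointed x0 ->
  [/\ ele (catinf act x0) (TCinf act),
      ele (TCinf act) (catinf (prod_act act) (x0, x0)) &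
      ele (catinf (prod_act act) (x0, x0)) (edouble (catinf act x0))].
Proof.
move=> grp actC _ _; have [act1 _ _] := actC.
have omap_idE (o : enat) : omap id o = o by case: o.
split.
- rewrite -[X in ele _ X]omap_idE.
  apply: (ele_einf_pos_secat (Pk_star act x0) (@qk X) (Pk act) (@pik X)).
  (* The cover of the square is pulled back along the slice through [x0], at the cost of one
     stage. *)
  move=> [//|m] n _ /secat_leP[U [oU cU sU]]; exists m.+2 => //.
  apply/secat_leP; exists (fun i => (fun x => (x0, x)) @^-1` U i); split=> [i||i].
  + by apply: open_comp => // x _; exact: pair_cst_continuous.
  + apply/seteqP; split=> // x _.
    have : (\bigcup_i U i) (x0, x) by rewrite cU.
    by case=> i _ Ui; exists i.
  + exact: local_section_TC_cat act1 (sU i).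
- rewrite -[X in ele _ X]omap_idE.
  apply: (ele_einf_pos_secat (Pk act) (@pik X) (Pk_star (prod_act act) (x0, x0)) (@qk (X * X)%type)).
  move=> [//|m] n _ /secat_leP[U [oU cU sU]]; exists (m.+1 + m.+1)%N => //.
  apply/secat_leP; exists U; split=> // i.
  exact: local_section_cat_TC grp actC (sU i).
- apply: (ele_einf_pos_secat (Pk_star (prod_act act) (x0, x0)) (@qk (X * X)%type)
    (Pk_star act x0) (@qk X)).
  by move=> k n k0 /(secat_le_cat_prod C); exists k.
Qed.
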